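(* Let $Q$ be a quiver of type $\mathbb{A}_n$ with an arbitrary orientation. Then $$C(\mathbb{A}_n)=P(Q),\qquad C^{\mathrm{clus}}(\mathbb{A}_n)=P^{\mathrm{clus}}(Q),\qquad C^+(\mathbb{A}_n)=P^+(Q).$$ In particular, $P(Q)$, $P^{\mathrm{clus}}(Q)$ and $P^+(Q)$ are convex and do not depend on the orientation of $Q$.
   Context: Let $k$ be a field and $n\ge 1$. A quiver $Q$ of type $\mathbb{A}_n$ has vertex set $Q_0=\{1,\dots,n\}$ and exactly one arrow between $i$ and $i+1$ for each $1\le i<n$, each arrow oriented arbitrarily. Modules are finite-dimensional representations of $Q$ over $k$, considered up to isomorphism; the dimension vector of $V$ is $\underline{\dim}\,V=(\dim V_1,\dots,\dim V_n)\in\mathbb{Z}^n$, and the support of $V$ is $\{i: V_i\neq 0\}$. For $I\subseteq Q_0$, $Q|_I$ denotes the full subquiver on $I$; its modules are identified with modules over $Q$ with support in $I$. A tilting module over $Q|_I$ is a module $T$ that is a direct sum of exactly $|I|$ pairwise non-isomorphic indecomposable modules with support in $I$ and satisfies $\mathrm{Ext}^1(T,T)=0$ (for $I=\emptyset$ the zero module). $\mathcal{T}^+(Q)$ is the set of tilting modules over $Q=Q|_{Q_0}$; $\mathcal{T}^{\mathrm{clus}}(Q)$ is the set of support tilting modules, i.e. modules $T$ that are tilting modules over $Q|_{\mathrm{supp}\,T}$; $\mathcal{T}(Q)$ is the set of $2$-support tilting modules, i.e. pairs $(T^+,T^-)$ with $T^+$ tilting over $Q|_I$ and $T^-$ tilting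 over $Q|_{Q_0\setminus I}$ for some $I\subseteq Q_0$. For a tilting module $T$ let $\sigma_T=\mathrm{conv}(\{0\}\cup\{\underline{\dim}\,X : X \text{ an indecomposable summand of } T\})$. For a support tilting module $T$ with support $I$ let $\sigma_T=\mathrm{conv}(\{0\}\cup\{\underline{\dim}\,X: X \text{ indecomposable summand of } T\}\cup\{-e_j: j\in Q_0\setminus I\})$. For a $2$-support tilting module $T=(T^+,T^-)$ let $\sigma_T=\mathrm{conv}(\{0\}\cup\{\underline{\dim}\,X: X\text{ indecomposable summand of }T^+\}\cup\{-\underline{\dim}\,Y: Y\text{ indecomposable summand of }T^-\})$. Define $P^+(Q)=\bigcup_{T\in\mathcal{T}^+(Q)}\sigma_T$, $P^{\mathrm{clus}}(Q)=\bigcup_{T\in\mathcal{T}^{\mathrm{clus}}(Q)}\sigma_T$, $P(Q)=\bigcup_{T\in\mathcal{T}(Q)}\sigma_T$. Let $\Phi^+=\{e_i+e_{i+1}+\dots+e_j: 1\le i\le j\le n\}\subset\mathbb{Z}^n$ (the positive roots of $\mathbb{A}_n$ in the basis of simple roots $e_1,\dots,e_n$). Define $C^+(\mathbb{A}_n)=\mathrm{conv}(\{0\}\cup\Phi^+)$, $C^{\mathrm{clus}}(\mathbb{A}_n)=\mathrm{conv}(\Phi^+\cup\{-e_1,\dots,-e_n\})$, $C(\mathbb{A}_n)=\mathrm{conv}(\Phi^+\cup(-\Phi^+))$. *)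

(* Defs.v *)
From HB Require Import structures.
From mathcomp Require Import all_boot all_order all_algebra.
Set Implicit Arguments. Unset Strict Implicit. Unset Printing Implicit Defensive.
Import Order.TTheory GRing.Theory Num.Theory.
Local Open Scope ring_scope.

(* ---------- Quivers of type A_n ----------
   Vertices: 'I_n (vertex i+1 of the paper is the ordinal i).
   Arrows: a : 'I_n.-1, joining vertices a and a+1.
   Orientation o : 'I_n.-1 -> bool; o a = true means a -> a+1,
   o a = false means a+1 -> a. *)

Lemma arrow_hi_lt n (a : 'I_n.-1) : (a.+1 < n)%N.
Proof. by case: n a => [|m] [a H]. Qed.

Definition alo n (a : 'I_n.-1) : 'I_n := widen_ord (leq_pred n) a.
Definition ahi n (a : 'I_n.-1) : 'I_n := Ordinal (arrow_hi_lt a).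

Definition asrc n (o : 'I_n.-1 -> bool) (a : 'I_n.-1) : 'I_n :=
  if o a then alo a else ahi a.
Definition atgt n (o : 'I_n.-1 -> bool) (a : 'I_n.-1) : 'I_n :=
  if o a then ahi a else alo a.

Section Reps.
Variables (k : fieldType) (n : nat) (o : 'I_n.-1 -> bool).

(* A finite-dimensional representation: V_i = k^(dimv i) (row vectors),
   and for each arrow a : s -> t a linear map k^(d s) -> k^(d t),
   given by a matrix acting on row vectors on the right. *)
Record rep := Rep {
  dimv : 'I_n -> nat ;
  repmap : forall a : 'I_n.-1, 'M[k]_(dimv (asrc o a), dimv (atgt o a))
}.

Definition rep0 : rep :=
  @Rep (fun _ => 0%N) (fun a => 0).

Definition support (V : rep) : {set 'I_n} := [set i | (0 < dimv V i)%N].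

Definition is_morph (V W : rep) (f : forall i, 'M[k]_(dimv V i, dimv W i)) :=
  forall a : 'I_n.-1,
    repmap V a *m f (atgt o a) = f (asrc o a) *m repmap W a.

Definition rep_iso (V W : rep) : Prop :=
  exists (f : forall i, 'M[k]_(dimv V i, dimv W i))
         (g : forall i, 'M[k]_(dimv W i, dimv V i)),
    [/\ is_morph f, is_morph g,
        forall i, f i *m g i = 1%:M & forall i, g i *m f i = 1%:M].

(* V is indecomposable: V <> 0, and whenever V = U (+) U' is an internal
   direct sum of two subrepresentations, U = 0 or U' = 0.
   Subspaces of V_i are given as row spaces of square matrices. *)
Definition subrep (V : rep) (U : forall i, 'M[k]_(dimv V i)) : Prop :=
  forall a : 'I_n.-1, (U (asrc o a) *m repmap V a <= U (atgt o a))%MS.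

Definition indecomposable (V : rep) : Prop :=
  (exists i, (0 < dimv V i)%N) /\
  forall U U' : forall i, 'M[k]_(dimv V i),
    subrep U -> subrep U' ->
    (forall i, (U i :&: U' i <= (0 : 'M[k]_(dimv V i)))%MS &&
               ((1%:M : 'M[k]_(dimv V i)) <= U i + U' i)%MS) ->
    (forall i, U i = 0) \/ (forall i, U' i = 0).

(* Ext^1(V,W) = 0, with Ext^1 defined as the cokernel of the standard map
   (Ringel's exact sequence)
     delta : (+)_i Hom_k(V_i,W_i) -> (+)_{a : s -> t} Hom_k(V_s, W_t),
     (f_i) |-> (V_a ; f_t - f_s ; W_a). *)
Definition ext1_zero (V W : rep) : Prop :=
  forall h : forall a : 'I_n.-1, 'M[k]_(dimv V (asrc o a), dimv W (atgt o a)),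
  exists f : forall i, 'M[k]_(dimv V i, dimv W i),
    forall a, h a = repmap V a *m f (atgt o a) - f (asrc o a) *m repmap W a.

(* A module T given by the list Ts of its indecomposable summands is a
   tilting module over Q|_I: exactly #|I| pairwise non-isomorphic
   indecomposable summands supported in I, and Ext^1(T,T) = 0
   (by additivity, Ext^1 vanishes between all pairs of summands). *)
Definition tilting_over (I : {set 'I_n}) (Ts : seq rep) : Prop :=
  [/\ size Ts = #|I|,
      forall i, (i < size Ts)%N ->
        indecomposable (nth rep0 Ts i) /\ support (nth rep0 Ts i) \subset I,
      forall i j, (i < size Ts)%N -> (j < size Ts)%N -> i <> j ->
        ~ rep_iso (nth rep0 Ts i) (nth rep0 Ts j)
    & forall i j, (i < size Ts)%N -> (j < size Ts)%N ->
        ext1_zero (nth rep0 Ts i) (nth rep0 Ts j)].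

Definition supp (Ts : seq rep) : {set 'I_n} :=
  [set i | has (fun X => (0 < dimv X i)%N) Ts].

End Reps.

Section Geometry.
Variables (R : realFieldType) (n : nat).

Definition conv (S : seq 'rV[R]_n) : 'rV[R]_n -> Prop :=
  fun x => exists w : 'I_(size S) -> R,
    [/\ forall i, 0 <= w i, \sum_i w i = 1
      & x = \sum_i w i *: S`_(nat_of_ord i)].

Definition evec (j : 'I_n) : 'rV[R]_n := delta_mx 0 j.

Definition dimvec (k : fieldType) (o : 'I_n.-1 -> bool) (V : rep k o)
  : 'rV[R]_n := \row_i (dimv V i)%:R.

Definition pos_roots : seq 'rV[R]_n :=
  [seq \row_l (((nat_of_ord ij.1 <= l) && (l <= nat_of_ord ij.2))%N)%:R
     | ij <- [seq (i, j) | i <- enum 'I_n, j <- enum 'I_n]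
     & (nat_of_ord ij.1 <= nat_of_ord ij.2)%N].
End Geometry.

Section Polytopes.
Variables (R : realFieldType) (k : fieldType) (n : nat) (o : 'I_n.-1 -> bool).

Local Notation dv := (@dimvec R n k o).

Definition sigma_plus (T : seq (rep k o)) : 'rV[R]_n -> Prop :=
  conv (0 :: map dv T).

Definition sigma_clus (T : seq (rep k o)) : 'rV[R]_n -> Prop :=
  conv (0 :: map dv T ++ [seq - evec R j | j <- enum (~: supp T)]).

Definition sigma2 (Tp Tm : seq (rep k o)) : 'rV[R]_n -> Prop :=
  conv (0 :: map dv Tp ++ map (fun Y => - dv Y) Tm).

Definition Pplus : 'rV[R]_n -> Prop :=
  fun x => exists T, tilting_over setT T /\ sigma_plus T x.

Definition Pclus : 'rV[R]_n -> Prop :=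
  fun x => exists T, tilting_over (supp T) T /\ sigma_clus T x.

Definition Pfull : 'rV[R]_n -> Prop :=
  fun x => exists (I : {set 'I_n}) Tp Tm,
    [/\ tilting_over I Tp, tilting_over (~: I) Tm & sigma2 Tp Tm x].

End Polytopes.

Section RootPolytopes.
Variables (R : realFieldType) (n : nat).

Definition Cplus : 'rV[R]_n -> Prop := conv (0 :: pos_roots R n).
Definition Cclus : 'rV[R]_n -> Prop :=
  conv (pos_roots R n ++ [seq - evec R j | j <- enum 'I_n]).
Definition Cfull : 'rV[R]_n -> Prop :=
  conv (pos_roots R n ++ map -%R (pos_roots R n)).
End RootPolytopes.

(* Main.v *)
From Pilot Require Import Defs.
From HB Require Import structures.
From mathcomp Require Import all_boot all_order all_algebra.
From mathcomp Require Import zify ring lra.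
(* [vector] also defines [dimv]; the one of [Defs] is meant below. *)
Import Pilot.Defs.
Set Implicit Arguments. Unset Strict Implicit. Unset Printing Implicit Defensive.
Import Order.TTheory GRing.Theory Num.Theory.
Local Open Scope ring_scope.

(* P in C: an indecomposable representation has a root as dimension vector.
   At the leftmost vertex of its support, the part of the representation lying
   to the right induces a flag, and a vector v together with a functional xi
   adapted to one step of this flag (xi v = 1) propagates to the right and
   splits off an interval module.

   C in P: reading the vertices from left to right, every nonnegative x with
   support in I is a nonnegative combination of the summands of a tilting
   module over Q|_I.  The interval modules ending at the current vertex are
   totally ordered by the existence of nonzero morphisms; at the next vertex
   they are all prolonged and a simple module is added if the coordinate grows,
   and otherwise this chain is cut at the place prescribed by the coordinate,
   the orientation of the arrow telling which side is prolonged.  The number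
   of intervals that start (with weights) is then as small as possible, so that
   the total weight is half of the sum of |x_i - x_(i-1)| over the edges of the
   path 0, x_1, ..., x_n, 0.  Applied to the positive and negative parts of x,
   this yields convex functions of x (with max(|v - u|, -(u + v)) instead of
   |v - u| in the cluster case) which are at most 2 at the vertices of C, hence
   on all of C, so the total weight is at most 1. *)

(** * Families of intervals without extensions *)

(* A pair [(a, b)] stands for the half-open interval of vertices [a <= i < b]. *)
Definition initv (p : nat * nat) : pred nat := fun i => (p.1 <= i < p.2)%N.

(** Tells when the summand [Hom(V_s, W_t)] of Ringel's sequence at the arrow [i] is nonzero, for the
    thin modules on [X] and [Y]. *)
Definition arrow_between (O : nat -> bool) (X Y : pred nat) i :=
  if O i then X i && Y i.+1 else X i.+1 && Y i.

(** Every extension equation then has an invertible coefficient at its left end, so that the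
    equations can be solved from right to left; [no_right_ext] is the mirror image. *)
Definition no_left_ext O X Y :=
  forall i, arrow_between O X Y i -> X i && Y i.
Definition no_right_ext O X Y :=
  forall i, arrow_between O X Y i -> X i.+1 && Y i.+1.
Definition ext_free O X Y := no_left_ext O X Y \/ no_right_ext O X Y.

(* [start_le a b]: for all large [c] there is a nonzero morphism from the
   module of the interval [(a, c)] to that of [(b, c)]. *)
Definition start_le (O : nat -> bool) a b :=
  (a == b) || (if (a < b)%N then ~~ O b.-1 else O a.-1).

Lemma start_lexx O a : start_le O a a.
Proof. by rewrite /start_le eqxx. Qed.

Lemma ext_free_same_end O a b m : ext_free O (initv (a, m)) (initv (b, m)).
Proof. by right=> i; rewrite /arrow_between /initv /=; case: (O i); lia. Qed.

(** As [p.2 < m], the added vertex [m] is not adjacent to [p], so no new arrow joins the two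
    intervals. *)
Lemma ext_free_grow O p c m : (p.2 < m)%N ->
  ext_free O (initv p) (initv (c, m)) -> ext_free O (initv p) (initv (c, m.+1)).
Proof.
case: p => a b /= bm [H|H]; [left|right] => i; move: (H i);
  rewrite /arrow_between /initv /=; case: (O i) => /=; lia.
Qed.

Lemma ext_free_growl O p c m : (p.2 < m)%N ->
  ext_free O (initv (c, m)) (initv p) -> ext_free O (initv (c, m.+1)) (initv p).
Proof.
case: p => a b /= bm [H|H]; [left|right] => i; move: (H i);
  rewrite /arrow_between /initv /=; case: (O i) => /=; lia.
Qed.

Lemma ext_free_empty O X m : ext_free O X (initv (m, m)).
Proof. by left=> i; rewrite /arrow_between /initv /=; case: (O i); lia. Qed.

Lemma ext_free_emptyl O X m : ext_free O (initv (m, m)) X.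
Proof. by left=> i; rewrite /arrow_between /initv /=; case: (O i); lia. Qed.

(** A violation at the arrow [i] needs one interval to start at [i.+1] and the other one further
    left; [start_le] makes this arrow point the harmless way. *)
Lemma no_left_ext_start_le O a b c d : start_le O a b ->
  no_left_ext O (initv (a, c)) (initv (b, d)).
Proof.
move=> leab i; rewrite /arrow_between /initv /=.
case: (eqVneq i.+1 (maxn a b)) => [im|]; last by case: (O i); lia.
move: leab; rewrite /start_le; case: ltngtP => //= ab.
- by rewrite (_ : b.-1 = i); [case: (O i) => //; lia | lia].
- by rewrite (_ : a.-1 = i); [case: (O i) => //; lia | lia].
- by case: (O i); lia.
Qed.

(** Solving from left to right can fail only at the arrow [m.-1], and only for the ordered pair
    singled out by its direction. That pair is solved from right to left, which is where the
    comparison of the starts enters. *)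
Lemma ext_free_cut O a b m :
  (if O m.-1 then start_le O a b else start_le O b a) ->
  ext_free O (initv (a, m)) (initv (b, m.+1)) /\
  ext_free O (initv (b, m.+1)) (initv (a, m)).
Proof.
case Om: (O m.-1) => leab; split.
- by left; apply: no_left_ext_start_le.
- right=> i; rewrite /arrow_between /initv /=.
  case: (eqVneq i m.-1) => [->|]; first by rewrite Om; lia.
  by case: (O i); lia.
- right=> i; rewrite /arrow_between /initv /=.
  case: (eqVneq i m.-1) => [->|]; first by rewrite Om; lia.
  by case: (O i); lia.
- by left; apply: no_left_ext_start_le.
Qed.

(** * Sweeping the vertices with weighted chains of interval starts *)

Section Sweep.
Variables (R : realFieldType) (O : nat -> bool) (I : pred nat) (y : nat -> R).
Hypothesis y_ge0 : forall i, 0 <= y i.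
Hypothesis y_off : forall i, ~~ I i -> y i = 0.

Definition weight T (L : seq (T * R)) := \sum_(z <- L) z.2.

Lemma weight_ge0 (T : eqType) (L : seq (T * R)) :
  (forall z, z \in L -> 0 <= z.2) -> 0 <= weight L.
Proof. by move=> L0; rewrite /weight big_seq; apply: sumr_ge0. Qed.

Lemma weight_mulr1 (T : Type) (L : seq (T * R)) : \sum_(z <- L) z.2 * 1 = weight L.
Proof. by apply: eq_bigr => z _; rewrite mulr1. Qed.

(** The entry in which the cumulative weight reaches [t] is cut in two, possibly with a zero
    part. *)
Lemma cut_weighted (T : eqType) (L : seq (T * R)) (t : R) :
  L != [::] -> (forall z, z \in L -> 0 <= z.2) -> 0 <= t <= weight L ->
  exists L1 a c1 c2 L2, [/\ L = L1 ++ (a, c1 + c2) :: L2, 0 <= c1, 0 <= c2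
    & weight L1 + c1 = t].
Proof.
elim: L t => // -[a c] L IH t _ L0 /andP[t0 tL].
have c0 : 0 <= c by apply: (L0 (a, c)); rewrite inE eqxx.
have {}L0 z : z \in L -> 0 <= z.2 by move=> zL; apply: L0; rewrite inE zL orbT.
rewrite /weight big_cons /= -/(weight L) in tL.
have [tc|ct] := lerP t c.
  exists [::], a, t, (c - t), L; rewrite /weight big_nil; split => //=; last by ring.
  - by rewrite addrC subrK.
  - by rewrite subr_ge0.
have Ln : L != [::].
  by apply/eqP=> L_nil; move: tL; rewrite L_nil /weight big_nil; lra.
have [|L1 [b [c1 [c2 [L2 [-> c10 c20 e]]]]]] := IH (t - c) Ln L0.
  by apply/andP; split; lra.
exists ((a, c) :: L1), b, c1, c2, L2; split => //.
by rewrite /weight big_cons /= -/(weight L1); lra.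
Qed.

(* The active interval starts [L] ending at [m] are distributed when vertex
   [m] is read: those in [E] are prolonged to [m] (possibly with the new start
   [m], of weight [w]), those in [F] stop. *)
Record split_step m (L E F : seq (nat * R)) (w : R) : Prop := SplitStep {
  split_subF : {subset unzip1 F <= unzip1 L};
  split_subE : {subset unzip1 E <= m :: unzip1 L};
  split_cover : forall a, a \in unzip1 L -> (a \in unzip1 E) || (a \in unzip1 F);
  split_uniqF : uniq (unzip1 F);
  split_uniqE : uniq (unzip1 E);
  split_orderE : pairwise (start_le O) (unzip1 E);
  split_ge0 : forall z, z \in E ++ F -> 0 <= z.2;
  split_cut : forall a b, a \in unzip1 F -> b \in unzip1 E ->
    if O m.-1 then start_le O a b else start_le O b a;
  split_sum : forall psi : nat -> R,
    \sum_(z <- E) z.2 * psi z.1 + \sum_(z <- F) z.2 * psi z.1 =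
    \sum_(z <- L) z.2 * psi z.1 + w * psi m;
  split_weightE : weight E = y m;
  split_size : (size E + size F = size L + I m)%N;
  split_new : I m -> E != [::];
  split_off : ~~ I m -> E = [::];
  split_w : 2 * w = `|y m - weight L| + y m - weight L }.

Lemma split_step_off m (L : seq (nat * R)) : ~~ I m ->
  uniq (unzip1 L) -> (forall z, z \in L -> 0 <= z.2) ->
  split_step m L [::] L 0.
Proof.
move=> Im uL L0; split=> //=.
- by move=> psi; rewrite big_nil mul0r add0r addr0.
- by rewrite /weight big_nil y_off.
- by rewrite (negbTE Im) addn0.
- by move=> Im'; rewrite Im' in Im.
- by rewrite y_off // sub0r normrN ger0_norm ?weight_ge0 //; ring.
Qed.

Lemma split_step_grow m (L : seq (nat * R)) : I m -> weight L <= y m ->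
  (forall a, a \in unzip1 L -> (a < m)%N) ->
  uniq (unzip1 L) -> pairwise (start_le O) (unzip1 L) ->
  (forall z, z \in L -> 0 <= z.2) ->
  exists E F w, split_step m L E F w.
Proof.
move=> Im Ly Lm uL pL L0; pose z0 := (m, y m - weight L).
(* The new start [m] carries the missing weight. It exceeds all other starts, hence is extreme for
   [start_le]: least if the arrow [m.-1] points to the right, greatest otherwise. *)
exists (if O m.-1 then z0 :: L else rcons L z0), [::], z0.2.
have pE : perm_eq (if O m.-1 then z0 :: L else rcons L z0) (z0 :: L).
  by case: ifP => _ //; rewrite perm_rcons.
have mE := perm_mem (perm_map fst pE); rewrite /= in mE.
have mL : m \notin unzip1 L by apply/negP => /Lm; rewrite ltnn.
split=> //=.
- by move=> a; rewrite mE.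
- by move=> a aL; rewrite mE inE aL orbT.
- by rewrite (perm_uniq (perm_map fst pE)) /= mL.
- have le_m a : a \in unzip1 L ->
    if O m.-1 then start_le O m a else start_le O a m.
    by move=> /Lm am; rewrite /start_le am ltnNge (ltnW am) /=; case: ifP => ->; rewrite orbT.
  case: ifP le_m => Om le_m /=; first by rewrite pL andbT; apply/allP.
  rewrite /unzip1 map_rcons -cats1 pairwise_cat pL /= andbT.
  by apply/allrelP => a b aL; rewrite inE => /eqP ->; apply: le_m.
- move=> z; rewrite cats0 (perm_mem pE) inE => /orP[/eqP->|/L0 //].
  by rewrite /= subr_ge0.
- by move=> psi; rewrite big_nil addr0 (perm_big _ pE) big_cons addrC.
- by rewrite /weight (perm_big _ pE) big_cons -/(weight L) /= subrK.
- by rewrite (perm_size pE) /= Im addn0 addn1.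
- by move=> _; rewrite -size_eq0 (perm_size pE).
- by rewrite Im.
- by rewrite ger0_norm ?subr_ge0 //; ring.
Qed.

(** No interval starts at [m]. The start at which the chain is cut is kept in both parts, once
    stopped and once prolonged, which supplies the additional summand demanded by [split_size]. *)
Lemma split_step_cut m (L : seq (nat * R)) : I m -> L != [::] -> y m <= weight L ->
  uniq (unzip1 L) -> pairwise (start_le O) (unzip1 L) ->
  (forall z, z \in L -> 0 <= z.2) ->
  exists E F w, split_step m L E F w.
Proof.
move=> Im Ln yL uL pL L0.
(* The prolonged part must weigh [y m]. By [split_cut] it is the tail of the chain if the arrow
   [m.-1] points to the right and the head otherwise; [t] is the weight of the head. *)
pose t := if O m.-1 then weight L - y m else y m.
have [|L1 [a [c1 [c2 [L2 [defL c10 c20 c1t]]]]]] := @cut_weighted _ L t Ln L0.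
  by rewrite /t; case: ifP => _; have := y_ge0 m; lra.
pose A := rcons L1 (a, c1); pose B := (a, c2) :: L2.
have AL : unzip1 A = rcons (unzip1 L1) a by rewrite /A /unzip1 map_rcons.
have L_eq : unzip1 L = unzip1 L1 ++ a :: unzip1 L2 by rewrite defL /unzip1 map_cat.
have subA : {subset unzip1 A <= unzip1 L}.
  by move=> b; rewrite AL L_eq mem_rcons mem_cat !inE => /orP[]->; rewrite ?orbT.
have subB : {subset unzip1 B <= unzip1 L}.
  by move=> b; rewrite L_eq mem_cat /= => ->; rewrite orbT.
have cov b : b \in unzip1 L -> (b \in unzip1 A) || (b \in unzip1 B).
  rewrite L_eq AL mem_cat => /orP[bL|bB]; first by rewrite mem_rcons inE bL orbT.
  by apply/orP; right.
have uA : uniq (unzip1 A).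
  by move: uL; rewrite AL L_eq -cat_rcons cat_uniq => /and3P[].
have uB : uniq (unzip1 B) by move: uL; rewrite L_eq cat_uniq => /and3P[].
have pA : pairwise (start_le O) (unzip1 A).
  by move: pL; rewrite AL L_eq -cat_rcons pairwise_cat => /and3P[].
have pB : pairwise (start_le O) (unzip1 B).
  by move: pL; rewrite L_eq pairwise_cat => /and3P[].
have leAB b c : b \in unzip1 A -> c \in unzip1 B -> start_le O b c.
  move: pL; rewrite L_eq pairwise_cat AL => /and3P[/allrelP r1 _].
  move=> /= /andP[/allP r2 _]; rewrite mem_rcons !inE.
  move=> /orP[/eqP->|bL] /orP[/eqP->|cL]; rewrite ?start_lexx //.
  - exact: r2.
  - by apply: r1; rewrite // inE eqxx.
  - by apply: r1; rewrite // inE cL orbT.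
have AB0 z : z \in A ++ B -> 0 <= z.2.
  rewrite mem_cat mem_rcons !inE -!orbA => /or4P[/eqP->|zL|/eqP->|zL] //;
    by apply: L0; rewrite defL mem_cat inE zL ?orbT.
have sumAB (psi : nat -> R) : \sum_(z <- A) z.2 * psi z.1 + \sum_(z <- B) z.2 * psi z.1 =
    \sum_(z <- L) z.2 * psi z.1.
  by rewrite /A -cats1 defL !big_cat !big_cons big_nil /=; ring.
have wA : weight A = t by rewrite /weight /A -cats1 big_cat big_seq1.
have wB : weight B = weight L - t.
  by have := sumAB (fun=> 1); rewrite !weight_mulr1; lra.
have sz : (size A + size B = size L + I m)%N.
  by rewrite defL Im size_rcons size_cat /=; lia.
have w0 : 2 * 0 = `|y m - weight L| + y m - weight L.
  by rewrite ler0_norm ?subr_le0 //; ring.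
have nE : ~~ I m -> B = [::] /\ A = [::] by rewrite Im.
move: wA wB; rewrite /t; case: ifP => Om wA wB.
- exists B, A, 0; split => //.
  + by move=> b /subB bL; rewrite inE bL orbT.
  + by move=> b; rewrite orbC; apply: cov.
  + by move=> z; rewrite mem_cat orbC -mem_cat; apply: AB0.
  + by rewrite Om.
  + by move=> psi; rewrite addrC sumAB mul0r addr0.
  + by rewrite wB; lra.
  + by rewrite addnC.
  + by rewrite Im.
- exists A, B, 0; split => //.
  + by move=> b /subA bL; rewrite inE bL orbT.
  + by rewrite Om => b c bB cA; apply: leAB.
  + by move=> psi; rewrite sumAB mul0r addr0.
  + by rewrite -size_eq0 size_rcons.
  + by rewrite Im.
Qed.

Lemma split_step_exists m (L : seq (nat * R)) :
  (forall a, a \in unzip1 L -> (a < m)%N) ->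
  uniq (unzip1 L) -> pairwise (start_le O) (unzip1 L) ->
  (forall z, z \in L -> 0 <= z.2) ->
  exists E F w, split_step m L E F w.
Proof.
move=> Lm uL pL L0; case: (boolP (I m)) => Im; last first.
  by exists [::], L, 0; apply: split_step_off.
have [Ly|yL] := lerP (weight L) (y m); first exact: split_step_grow.
apply: split_step_cut (ltW yL) _ _ _ => //.
by apply/eqP=> L_nil; move: yL; rewrite L_nil /weight big_nil ltNge y_ge0.
Qed.

Definition shift (f : nat -> R) m := if m is i.+1 then f i else 0.

Definition close_at (m : nat) (L : seq (nat * R)) := [seq ((z.1, m), z.2) | z <- L].

Lemma unzip1_close (m : nat) L : unzip1 (close_at m L) = [seq (a, m) | a <- unzip1 L].
Proof. by rewrite /unzip1 -!map_comp. Qed.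

Lemma mem_close m L p :
  p \in unzip1 (close_at m L) -> exists2 a, a \in unzip1 L & p = (a, m).
Proof. by rewrite unzip1_close => /mapP. Qed.

Lemma mem_unzip1 (T : eqType) (L : seq (T * R)) z : z \in L -> z.1 \in unzip1 L.
Proof. exact: map_f. Qed.

(* After reading the vertices below [m]: [D] lists the weighted intervals that
   stopped before [m], and [L] the starts of those still prolongable to [m]. *)
Record sweep m D (L : seq (nat * R)) : Prop := Sweep {
  sweep_start : forall a, a \in unzip1 L -> (a < m)%N;
  sweep_uniqL : uniq (unzip1 L);
  sweep_order : pairwise (start_le O) (unzip1 L);
  sweep_ge0 : forall z, z \in D ++ close_at m L -> 0 <= z.2;
  sweep_dead : forall p, p \in unzip1 D -> (p.1 < p.2 < m)%N;
  sweep_uniqD : uniq (unzip1 D);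
  sweep_in : forall p i, p \in unzip1 (D ++ close_at m L) -> initv p i -> I i;
  sweep_ext : forall p q, p \in unzip1 (D ++ close_at m L) ->
    q \in unzip1 (D ++ close_at m L) -> ext_free O (initv p) (initv q);
  sweep_sum : forall i, \sum_(z <- D ++ close_at m L) z.2 * (initv z.1 i)%:R =
    if (i < m)%N then y i else 0;
  sweep_weight : weight L = shift y m;
  sweep_total : 2 * weight (D ++ close_at m L) =
    \sum_(0 <= i < m) `|y i - shift y i| + shift y m;
  sweep_size : size (D ++ close_at m L) = count I (iota 0 m);
  sweep_cover : forall i, (i < m)%N -> I i ->
    exists2 p, p \in unzip1 (D ++ close_at m L) & initv p i }.

Lemma sweep0 : sweep 0 [::] [::].
Proof.
split => //=; rewrite /weight ?big_nil //= ?big_geq //; last by rewrite mulr0 addr0.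
by move=> i; rewrite big_nil.
Qed.

Lemma sum_close m L (psi : nat * nat -> R) :
  \sum_(z <- close_at m L) z.2 * psi z.1 = \sum_(z <- L) z.2 * psi (z.1, m).
Proof. by rewrite big_map. Qed.

Lemma unzip1_cat (T : Type) (s t : seq (T * R)) : unzip1 (s ++ t) = unzip1 s ++ unzip1 t.
Proof. exact: map_cat. Qed.

Lemma sweepS m D L : sweep m D L -> exists D' L', sweep m.+1 D' L'.
Proof.
move=> S; have [Lm uL oL S0 SD uD SI Sext Ssum Sw Stot Ssz Scov] := S.
have L0 z : z \in L -> 0 <= z.2.
  by move=> zL; apply: (S0 (z.1, m, z.2)); rewrite mem_cat orbC
    (map_f (fun z => ((z.1, m), z.2)) zL).
have [E [F [w [FL EL LEF uF uE oE EF0 cut sumEF wE sz new off ww]]]] :=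
  split_step_exists Lm uL oL L0.
have memL a : a \in unzip1 L -> (a, m) \in unzip1 (D ++ close_at m L).
  by move=> aL; rewrite unzip1_cat mem_cat unzip1_close (map_f (pair^~ m) aL) orbT.
have memD p : p \in unzip1 D -> p \in unzip1 (D ++ close_at m L).
  by move=> pD; rewrite unzip1_cat mem_cat pD.
exists (D ++ close_at m F), E.
have memP p : p \in unzip1 ((D ++ close_at m F) ++ close_at m.+1 E) ->
   [\/ p \in unzip1 D, exists2 a, a \in unzip1 F & p = (a, m)
     | exists2 a, a \in unzip1 E & p = (a, m.+1)].
  rewrite !unzip1_cat !mem_cat -orbA => /or3P[?|/mem_close|/mem_close]; by
    [constructor 1 | constructor 2 | constructor 3].
have Em a : a \in unzip1 E -> (a <= m)%N.
  by move=> /EL; rewrite inE => /orP[/eqP->|/Lm /ltnW].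
have sumE (psi : nat * nat -> R) :
  \sum_(z <- (D ++ close_at m F) ++ close_at m.+1 E) z.2 * psi z.1 =
  \sum_(z <- D) z.2 * psi z.1 + \sum_(z <- F) z.2 * psi (z.1, m) +
  \sum_(z <- E) z.2 * psi (z.1, m.+1).
  by rewrite !big_cat /= !sum_close.
split=> //.
- move=> z; rewrite !mem_cat -orbA => /or3P[zD|/mapP[x xF ->]|/mapP[x xE ->]].
  + by apply: S0; rewrite mem_cat zD.
  + by apply: EF0; rewrite mem_cat xF orbT.
  + by apply: EF0; rewrite mem_cat xE.
- move=> p; rewrite unzip1_cat mem_cat => /orP[/SD|/mem_close[a /FL /Lm am ->]] /=.
    by move=> /andP[-> /= pm]; apply: ltnW.
  by rewrite am ltnSn.
- rewrite unzip1_cat unzip1_close cat_uniq uD /= map_inj_uniq ?uF ?andbT; last by move=> ? ? [].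
  apply/hasPn => _ /mapP[a _ ->]; apply/negP => /SD /=.
  by rewrite ltnn andbF.
- move=> p i /memP[/memD/SI|[a /FL /memL aL ->]|[a aE ->]]; [exact | exact: SI |].
  have Im : I m by apply: contraT => /off E_nil; rewrite E_nil in aE.
  rewrite /initv /= => ai; case: (eqVneq i m) => [-> //|im].
  have /EL := aE; rewrite inE => /orP[/eqP am|/memL aL]; first by lia.
  by apply: (SI _ i aL); rewrite /initv /=; lia.
(* Intervals in [D] end strictly before [m]. A new start [m] is viewed as the empty interval
   [(m, m)] prolonged by one vertex. *)
- have extD p a : p \in unzip1 D -> a \in unzip1 E ->
     ext_free O (initv p) (initv (a, m.+1)) /\ ext_free O (initv (a, m.+1)) (initv p).
    move=> pD /EL; have /andP[_ pm] := SD _ pD.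
    rewrite inE => /orP[/eqP->|/memL aL].
      by split; [apply: ext_free_grow => //; apply: ext_free_empty
                |apply: ext_free_growl => //; apply: ext_free_emptyl].
    by split; [apply: ext_free_grow | apply: ext_free_growl] => //; apply: Sext => //; apply: memD.
  move=> p q /memP[pD|[a aF ->]|[a aE ->]] /memP[qD|[b bF ->]|[b bE ->]].
  + by apply: Sext; apply: memD.
  + by apply: Sext; [apply: memD | apply/memL/FL].
  + by have [] := extD _ _ pD bE.
  + by apply: Sext; [apply/memL/FL | apply: memD].
  + exact: ext_free_same_end.
  + by have [] := ext_free_cut (cut _ _ aF bE).
  + by have [] := extD _ _ qD aE.
  + by have [] := ext_free_cut (cut _ _ bF aE).
  + exact: ext_free_same_end.
(* Only the intervals of [E] contain [m], and they weigh [y m]. Away from [m], prolonging changes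
   nothing and [E], [F] recombine to [L]. *)
- move=> i; rewrite (sumE (fun p => (initv p i)%:R)); case: (eqVneq i m) => [->|im].
  + rewrite ltnSn big_seq big1 ?add0r; last first.
      move=> z /mem_unzip1 /SD zm; suff -> : initv z.1 m = false by rewrite mulr0.
      by rewrite /initv; case: (z.1) zm => a b /=; lia.
    rewrite big1 ?add0r; last by move=> z _; rewrite /initv /= ltnn andbF mulr0.
    rewrite -wE /weight; apply: eq_big_seq => z /mem_unzip1 /Em zm.
    by rewrite /initv /= zm ltnSn mulr1.
  + have -> : (i < m.+1)%N = (i < m)%N by lia.
    rewrite -Ssum big_cat /= (sum_close m L (fun p => (initv p i)%:R)).
    have := sumEF (fun a => (initv (a, m) i)%:R).
    have -> : initv (m, m) i = false by rewrite /initv /=; lia.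
    rewrite mulr0 addr0 => <-; rewrite -addrA; congr (_ + _); rewrite addrC; congr (_ + _).
    apply: eq_bigr => z _; congr (_ * _%:R); congr nat_of_bool.
    by rewrite /initv /=; lia.
(* The added weight is [w]. Since [weight L = shift y m], [2 * w] is the new edge term plus
   [y m - shift y m], which updates the boundary term. *)
- rewrite -weight_mulr1 (sumE (fun=> 1)) big_nat_recr //= !weight_mulr1.
  have := sumEF (fun=> 1); rewrite !weight_mulr1 mulr1 wE => e.
  move: Stot; rewrite /weight big_cat /= -/(weight D) -/(weight F) -/(weight (close_at m L)).
  have -> : weight (close_at m L) = weight L by rewrite /weight big_map.
  by move: ww; rewrite Sw; move: e; rewrite Sw; lra.
- have -> : iota 0 m.+1 = iota 0 m ++ [:: m] by rewrite -addn1 iotaD.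
  rewrite count_cat -Ssz /= addn0 !size_cat !size_map.
  by move: sz; lia.
- move=> i im Ii; case: (eqVneq i m) Ii => [->|neq] Ii.
    have := new Ii.
    case: E EL memP Em {LEF uE oE EF0 cut sumEF wE sz new off sumE} => //.
    move=> -[a c] E EL memP Em _.
    exists (a, m.+1); first by rewrite unzip1_cat mem_cat unzip1_close inE eqxx orbT.
    by rewrite /initv /= ltnSn andbT; apply: Em; rewrite inE eqxx.
  have [|p] := Scov i _ Ii; first by lia.
  rewrite unzip1_cat mem_cat => /orP[pD|/mem_close[a /LEF aEF ->]] pi.
    by exists p => //; rewrite !unzip1_cat !mem_cat pD.
  case/orP: aEF => aEF.
  + exists (a, m.+1); last by move: pi; rewrite /initv /=; lia.
    by rewrite !unzip1_cat !mem_cat !unzip1_close (map_f (pair^~ m.+1) aEF) !orbT.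
  + exists (a, m) => //.
    by rewrite !unzip1_cat !mem_cat !unzip1_close (map_f (pair^~ m) aEF) !orbT.
Qed.

Lemma sweep_exists m : exists D L, sweep m D L.
Proof.
elim: m => [|m [D [L /sweepS]]]; last exact.
by exists [::], [::]; exact: sweep0.
Qed.

(** The active intervals are closed at [m]. Intervals of weight zero are kept, because a tilting
    module needs as many summands as there are vertices in [I]. *)
Lemma rigid_family m : exists Z : seq ((nat * nat) * R),
  [/\ [/\ forall z, z \in Z -> 0 <= z.2,
           uniq (unzip1 Z) & forall p, p \in unzip1 Z -> (p.1 < p.2 <= m)%N],
      [/\ forall p i, p \in unzip1 Z -> initv p i -> I i,
           forall i, (i < m)%N -> I i -> exists2 p, p \in unzip1 Z & initv p i
         & size Z = count I (iota 0 m)],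
      forall p q, p \in unzip1 Z -> q \in unzip1 Z -> ext_free O (initv p) (initv q),
      forall i, (i < m)%N -> \sum_(z <- Z) z.2 * (initv z.1 i)%:R = y i
    & 2 * weight Z = \sum_(0 <= i < m) `|y i - shift y i| + shift y m].
Proof.
have [D [L [Lm uL oL S0 SD uD SI Sext Ssum Sw Stot Ssz Scov]]] := sweep_exists m.
exists (D ++ close_at m L); split => //; first split => //.
- rewrite unzip1_cat unzip1_close cat_uniq uD /= map_inj_uniq ?uL ?andbT; last by move=> ? ? [].
  apply/hasPn => _ /mapP[a _ ->]; apply/negP => /SD /=.
  by rewrite ltnn andbF.
- move=> p; rewrite unzip1_cat mem_cat => /orP[/SD/andP[-> /ltnW //]|/mem_close[a /Lm am ->]].
  by rewrite /= am leqnn.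
- by move=> i im; rewrite Ssum im.
Qed.

End Sweep.

(** * Indecomposable representations are intervals *)

(** The rows of [1 - M *m pinvmx M] are relations among the rows of [M], hence annihilate [b]. *)
Lemma mulmx_solvable (k : fieldType) p q r (M : 'M[k]_(p, q)) (b : 'M_(p, r)) :
  kermx M *m b = 0 -> exists X, M *m X = b.
Proof.
move=> kb; exists (pinvmx M *m b).
have /submxP[D e] : (1%:M - M *m pinvmx M <= kermx M)%MS.
  by apply/sub_kermxP; rewrite mulmxBl mul1mx mulmxKpV ?subrr.
have : (1%:M - M *m pinvmx M) *m b = 0 by rewrite e -mulmxA kb mulmx0.
by rewrite mulmxBl mul1mx mulmxA => /eqP; rewrite subr_eq0 => /eqP <-.
Qed.

Lemma separate_submx (k : fieldType) p q r (A : 'M[k]_(p, r)) (B : 'M[k]_(q, r)) :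
  ~~ (B <= A)%MS -> exists (v : 'rV[k]_r) (xi : 'cV[k]_r),
    [/\ (v <= B)%MS, A *m xi = 0 & v *m xi = 1%:M].
Proof.
case/row_subPn=> i; rewrite submxE => /rV0Pn[j nz].
exists (((row i B *m cokermx A) 0 j)^-1 *: row i B), (col j (cokermx A)); split.
- by rewrite scalemx_sub // row_sub.
- by rewrite colE mulmxA mulmx_coker mul0mx.
- apply/matrixP => a b; rewrite !ord1 -scalemxAl mxE colE mulmxA -colE.
  by rewrite [col _ _ _ _]mxE mulVf // mxE.
Qed.

Section IntervalSummand.
Variables (k : fieldType) (n : nat) (o : 'I_n.-1 -> bool) (V : rep k o).

Implicit Types (v : forall i, 'rV[k]_(dimv V i)) (xi : forall i, 'cV[k]_(dimv V i)).

(** The arrow preserves the lines spanned by [v] and the kernels of [xi]: the functional at the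
    target pulls back to a scalar multiple, by [c], of the one at the source. *)
Definition arrow_stable v xi (a : 'I_n.-1) :=
  (v (asrc o a) *m repmap V a <= v (atgt o a))%MS /\
  exists c, repmap V a *m xi (atgt o a) = xi (asrc o a) *m c.

Definition interval_pair (m : 'I_n) (j : nat) v xi :=
  [/\ (m <= j)%N,
      forall i : 'I_n, (m <= i <= j)%N -> v i *m xi i = 1%:M,
      forall i : 'I_n, ~~ (m <= i <= j)%N -> v i = 0 /\ xi i = 0
    & forall a : 'I_n.-1, (m <= a)%N -> arrow_stable v xi a].

Lemma arrow_neq (a : 'I_n.-1) (m : 'I_n) : (m < a)%N -> m != asrc o a /\ m != atgt o a.
Proof.
by move=> ma; rewrite /asrc /atgt; case: (o a); rewrite -!(inj_eq val_inj) /=; lia.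
Qed.

Definition zero_rows (i : 'I_n) : 'rV[k]_(dimv V i) := 0.
Definition zero_cols (i : 'I_n) : 'cV[k]_(dimv V i) := 0.

Lemma interval_pair_stop (m : 'I_n) (v : 'rV[k]_(dimv V m)) (xi : 'cV[k]_(dimv V m)) :
  let vs := dfwith zero_rows v in let xis := dfwith zero_cols xi in
  v *m xi = 1%:M ->
  (forall a : 'I_n.-1, m = a :> nat -> arrow_stable vs xis a) ->
  interval_pair m m vs xis.
Proof.
move=> vs xis vxi Ha; split=> //.
- move=> i; rewrite -eqn_leq => /eqP mi; have {mi} <- : m = i by apply: val_inj.
  by rewrite /vs /xis !dfwith_in.
- move=> i; rewrite -eqn_leq => mi.
  by rewrite /vs /xis !dfwith_out //; apply: contraNneq mi => ->.
- move=> a; rewrite leq_eqVlt => /orP[/eqP/Ha //|/arrow_neq[sn tn]].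
  rewrite /arrow_stable /vs /xis !dfwith_out // /zero_rows /zero_cols.
  rewrite mul0mx sub0mx mulmx0; split=> //.
  by exists 0; rewrite mulmx0.
Qed.

Lemma interval_pair_extend (a : 'I_n.-1) j v' xi'
    (v : 'rV[k]_(dimv V (alo a))) (xi : 'cV[k]_(dimv V (alo a))) :
  let vs := dfwith v' v in let xis := dfwith xi' xi in
  interval_pair (ahi a) j v' xi' -> v *m xi = 1%:M -> arrow_stable vs xis a ->
  interval_pair (alo a) j vs xis.
Proof.
move=> vs xis [aj v1 v0 va] vxi Ha; split=> //=.
- exact: ltnW.
- move=> i; have [<-|ni] := eqVneq (alo a) i; first by rewrite /vs /xis !dfwith_in.
  rewrite /vs /xis !dfwith_out // => ij; apply: v1 => /=.
  by move: ni ij; rewrite -(inj_eq val_inj) /=; lia.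
- move=> i; have [<-|ni] := eqVneq (alo a) i; first by rewrite /= leqnn (ltnW aj).
  rewrite /vs /xis !dfwith_out // => ij; apply: v0 => /=.
  by move: ni ij; rewrite -(inj_eq val_inj) /=; lia.
- move=> b; rewrite leq_eqVlt => /orP[/eqP ab|ab]; first by have <- : a = b by apply: val_inj.
  have [sn tn] := @arrow_neq b (alo a) ab.
  by rewrite /arrow_stable /vs /xis !dfwith_out //; apply: va.
Qed.

(** Induction on the number of vertices to the right. If some vector of [B] outside [A] is killed by
    the next arrow, or is not reached by it modulo [A], the interval ends at [m]. Otherwise the
    images or preimages of [A] and [B] still form a proper inclusion, and the pair found for them is
    carried back. *)
Lemma interval_pair_exists (m : 'I_n) p q
    (A : 'M[k]_(p, dimv V m)) (B : 'M[k]_(q, dimv V m)) :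
  (A <= B)%MS -> ~~ (B <= A)%MS ->
  exists j v xi, [/\ interval_pair m j v xi, (v m <= B)%MS & A *m xi m = 0].
Proof.
move: {2}(n - m)%N (leqnn (n - m)) => r.
elim: r m p q A B => [|r IH] m p q A B.
  by have := ltn_ord m; lia.
move=> nr AB BA.
have [mn|mn] := ltnP m.+1 n; last first.
  have [v [xi [vB Axi vxi]]] := separate_submx BA.
  have P := interval_pair_stop vxi.
  exists m, (dfwith zero_rows v), (dfwith zero_cols xi); rewrite !dfwith_in; split=> //.
  by apply: P => a ma; have := ltn_ord a; lia.
have an : (m < n.-1)%N by lia.
have [a Em] : exists a : 'I_n.-1, alo a = m by exists (Ordinal an); apply: val_inj.
case: m / Em {an} nr A B AB BA mn => /= nr A B AB BA mn.
have stop (v : 'rV[k]_(dimv V (alo a))) (xi : 'cV[k]_(dimv V (alo a))) :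
  (v <= B)%MS -> A *m xi = 0 -> v *m xi = 1%:M ->
  arrow_stable (dfwith zero_rows v) (dfwith zero_cols xi) a ->
  exists j v xi, [/\ interval_pair (alo a) j v xi, (v (alo a) <= B)%MS & A *m xi (alo a) = 0].
  move=> vB Axi vxi Ha; have P := interval_pair_stop vxi.
  exists (alo a), (dfwith zero_rows v), (dfwith zero_cols xi); rewrite !dfwith_in; split=> //.
  by apply: P => b ab; have <- : a = b by apply: val_inj.
have {}IH := IH (ahi a) _ _; have {}nr : (n - ahi a <= r)%N by move: nr => /=; lia.
have nlh : alo a != ahi a by rewrite -(inj_eq val_inj) /=; lia.
case oa: (o a).
- have [f Hf] : exists f : 'M[k]_(dimv V (alo a), dimv V (ahi a)), forall v xi,
      (v (alo a) *m f <= v (ahi a))%MS /\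
      (exists c, f *m xi (ahi a) = xi (alo a) *m c) -> arrow_stable v xi a.
    by rewrite /arrow_stable; move: (repmap V a); rewrite /asrc /atgt oa => f; exists f.
  have [BkA|/separate_submx[v [xi [vBk Axi vxi]]]] := boolP ((B :&: kermx f)%MS <= A)%MS.
    have [|j [v [xi [P vB Axi]]]] := IH _ _ (A *m f) (B *m f) nr (submxMr f AB).
      apply: contra BA => /submxP[D e]; suff : (B - D *m A <= A)%MS.
        by move=> /addmx_sub /(_ (submxMl D A)); rewrite subrK.
      apply: submx_trans BkA; rewrite sub_capmx; apply/andP; split.
        by rewrite addmx_sub // eqmx_opp (submx_trans (submxMl D A)).
      by apply/sub_kermxP; rewrite mulmxBl e mulmxA subrr.
    have [_ v1 _ _] := P; have {}v1 : v (ahi a) *m xi (ahi a) = 1%:M.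
      by apply: v1; rewrite leqnn; case: P.
    have /submxP[w ew] := vB.
    exists j, (dfwith v (w *m B)), (dfwith xi (f *m xi (ahi a))).
    split; rewrite ?dfwith_in ?submxMl //; last by rewrite mulmxA.
    apply: interval_pair_extend P _ _; first by rewrite mulmxA -(mulmxA w) -ew.
    apply: Hf; rewrite !dfwith_in !dfwith_out // -mulmxA -ew submx_refl; split=> //.
    by exists 1%:M; rewrite mulmx1.
  move: vBk; rewrite sub_capmx => /andP[vB /sub_kermxP vf].
  apply: (stop v xi) => //; apply: Hf.
  rewrite !dfwith_in !dfwith_out // vf /zero_rows /zero_cols sub0mx; split=> //.
  by exists 0; rewrite !mulmx0.
- have [f Hf] : exists f : 'M[k]_(dimv V (ahi a), dimv V (alo a)), forall v xi,
      (v (ahi a) *m f <= v (alo a))%MS /\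
      (exists c, f *m xi (alo a) = xi (ahi a) *m c) -> arrow_stable v xi a.
    by rewrite /arrow_stable; move: (repmap V a); rewrite /asrc /atgt oa => f; exists f.
  have [BAf|/separate_submx[v [xi [vB Axi vxi]]]] := boolP (B <= A + f)%MS.
    (* The preimage under [f] of the row space of [C]. *)
    pose pre c (C : 'M[k]_(c, dimv V (alo a))) := kermx (f *m cokermx C).
    have preP c d (w : 'M[k]_(c, _)) (C : 'M[k]_(d, dimv V (alo a))) :
        (w <= pre _ C)%MS = (w *m f <= C)%MS.
      by rewrite [in RHS]submxE -mulmxA; apply/sub_kermxP/eqP.
    have [||j [v [xi [P vB Axi]]]] := IH _ _ (pre _ A) (pre _ B) nr.
    + by rewrite preP (submx_trans _ AB) // -preP.
    + apply: contra BA => BA; have /sub_addsmxP[[D1 D2] /= e] := BAf.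
      have D2B : (D2 <= pre _ B)%MS.
        rewrite preP (_ : D2 *m f = B - D1 *m A); last by rewrite e addrC addKr.
        by rewrite addmx_sub // eqmx_opp (submx_trans (submxMl D1 A)).
      by rewrite e addmx_sub ?submxMl // -preP (submx_trans D2B).
    have [_ v1 _ _] := P; have {}v1 : v (ahi a) *m xi (ahi a) = 1%:M.
      by apply: v1; rewrite leqnn; case: P.
    (* The functional sought restricts along [f] to the given one and vanishes on [A]. This is
       consistent: [K1 *m f + K2 *m A = 0] puts [K1] in the preimage of [A], which [xi (ahi a)]
       kills. *)
    have [|x] := @mulmx_solvable _ _ _ _ (col_mx f A) (col_mx (xi (ahi a)) 0).
      have := mulmx_ker (col_mx f A); rewrite -[kermx _]hsubmxK !mul_row_col mulmx0 addr0.
      set K1 := lsubmx _; set K2 := rsubmx _ => e.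
      have /submxP[D ->] : (K1 <= pre _ A)%MS.
        rewrite preP; have -> : K1 *m f = - K2 *m A.
          by apply/eqP; rewrite mulNmx -addr_eq0 e.
        exact: submxMl.
      by rewrite -mulmxA Axi mulmx0.
    rewrite mul_col_mx => /eq_col_mx[fx Ax].
    exists j, (dfwith v (v (ahi a) *m f)), (dfwith xi x).
    split; rewrite ?dfwith_in // -?preP //.
    apply: interval_pair_extend P _ _; first by rewrite -mulmxA fx.
    apply: Hf; rewrite !dfwith_in !dfwith_out // submx_refl; split=> //.
    by exists 1%:M; rewrite mulmx1.
  have {}Axi : A *m xi = 0 /\ f *m xi = 0.
    have kill c (C : 'M[k]_(c, _)) : (C <= A + f)%MS -> C *m xi = 0.
      by move=> /submxP[D ->]; rewrite -mulmxA Axi mulmx0.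
    by rewrite !kill ?addsmxSl ?addsmxSr.
  apply: (stop v xi) => //; first by case: Axi.
  apply: Hf; rewrite !dfwith_in !dfwith_out // /zero_rows /zero_cols mul0mx sub0mx; split=> //.
  by exists 0; rewrite !mulmx0; case: Axi.
Qed.

(** On the interval, [xi i *m v i] is the projection onto the line along the kernel; elsewhere the
    line is zero and the kernel is everything. *)
Lemma interval_pair_split m j v xi : interval_pair m j v xi ->
  forall i, ((<<v i>> :&: kermx (xi i) <= (0 : 'M[k]_(dimv V i)))%MS &&
             ((1%:M : 'M[k]_(dimv V i)) <= <<v i>> + kermx (xi i))%MS).
Proof.
move=> [_ v1 v0 _] i; have [/v1 vxi|/v0[-> ->]] := boolP (m <= i <= j)%N; apply/andP; split.
- set W := (_ :&: _)%MS; have /submxP[D e] : (W <= v i)%MS by rewrite -(genmxE (v i)) capmxSl.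
  have : (W <= kermx (xi i))%MS by rewrite capmxSr.
  by rewrite e => /sub_kermxP; rewrite -mulmxA vxi mulmx1 => ->; rewrite mul0mx sub0mx.
- rewrite -(subrK (xi i *m v i) 1%:M) addrC addmx_sub_adds //.
    by rewrite genmxE submxMl.
  by apply/sub_kermxP; rewrite mulmxBl mul1mx -mulmxA vxi mulmx1 subrr.
- by rewrite (submx_trans (capmxSl _ _)) // genmxE sub0mx.
- by apply: submx_trans (addsmxSr _ _); apply/sub_kermxP; rewrite mulmx0.
Qed.

Lemma indecomposable_interval : indecomposable V ->
  exists i j : 'I_n, (i <= j)%N /\ forall l : 'I_n, dimv V l = (i <= l <= j)%N :> nat.
Proof.
case=> -[i0 Vi0] split_V.
case: (@arg_minnP _ i0 (fun i => 0 < dimv V i)%N val Vi0) => m Vm min_m.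
have [||j [v [xi [P _ _]]]] :=
  @interval_pair_exists m _ _ (0 : 'M_(dimv V m)) (1%:M : 'M_(dimv V m)).
- exact: sub0mx.
- by rewrite submx0 -mxrank_eq0 mxrank1 -lt0n.
(* To the left of [m] each arrow has a zero space at its left end, so its map vanishes. *)
have st a : arrow_stable v xi a.
  have [_ _ _ va] := P; have [/va //|am] := leqP m a.
  have Vlo : dimv V (alo a) = 0%N.
    by apply/eqP; rewrite -leqn0 leqNgt; apply/negP => /min_m /=; rewrite leqNgt am.
  have f0 : repmap V a = 0.
    move: (repmap V a); rewrite /asrc /atgt.
    by case: (o a); move: (dimv V (alo a)) Vlo => d -> f; rewrite ?flatmx0 ?thinmx0.
  by rewrite /arrow_stable f0 mulmx0 sub0mx mul0mx; split=> //; exists 0; rewrite mulmx0.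
have [mj v1 v0 _] := P.
have [] := split_V (fun i => <<v i>>%MS) (fun i => kermx (xi i)).
- move=> a; have [sv _] := st a.
  by rewrite genmxE (eqmxMr _ (genmxE _)).
- move=> a; have [_ [c e]] := st a.
  by apply/sub_kermxP; rewrite -mulmxA e mulmxA mulmx_ker mul0mx.
- exact: interval_pair_split P.
- move=> /(_ m) /eqP; rewrite -submx0 genmxE submx0 => /eqP vm.
  by have := v1 m; rewrite leqnn mj vm mul0mx => /(_ isT)/matrixP/(_ 0 0)/eqP;
    rewrite !mxE eq_sym oner_eq0.
(* The kernels are zero, so [xi] embeds every space into a line. *)
- move=> ker0.
  have rk l : dimv V l = \rank (xi l).
    by apply/esym/eqP; rewrite -[_ == _]/(row_free _) -kermx_eq0 ker0.
  have dimV l : dimv V l = (m <= l <= j)%N :> nat.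
    case: (boolP (m <= l <= j)%N) => [/v1 vxi|/v0[_ xi0]]; last by rewrite rk xi0 mxrank0.
    apply/eqP; rewrite eqn_leq {1}rk rank_leq_col lt0n rk mxrank_eq0.
    apply/eqP=> xi0; move/matrixP/(_ 0 0)/eqP: vxi.
    by rewrite xi0 mulmx0 !mxE eq_sym oner_eq0.
  (* The natural number [j] is not bounded by [interval_pair], so it is capped at the last
     vertex. *)
  have jn : (minn j n.-1 < n)%N by have := ltn_ord m; lia.
  exists m, (Ordinal jn); split=> [|l] /=; first by have := ltn_ord m; lia.
  by rewrite dimV; congr nat_of_bool; have := ltn_ord l; lia.
Qed.

End IntervalSummand.

(** * Interval modules *)

Lemma rec_down_exists (T : Type) (g : nat -> T -> T) (x : T) N :
  exists phi : nat -> T, forall i, (i < N)%N -> phi i = g i (phi i.+1).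
Proof.
exists (fun i => foldr g x (iota i (N - i))) => i iN.
by rewrite subnS; case: (N - i)%N (subn_gt0 i N) => [|d] //=; rewrite iN.
Qed.

Lemma rec_up_exists (T : Type) (g : nat -> T -> T) (x : T) :
  exists phi : nat -> T, forall i, phi i.+1 = g i (phi i).
Proof. by exists (fix phi i := if i is j.+1 then g j (phi j) else x). Qed.

Section IntervalModules.
Variables (k : fieldType) (n : nat) (o : 'I_n.-1 -> bool).

Definition onat (i : nat) : bool :=
  if (insub i : option 'I_n.-1) is Some a then o a else false.

Lemma onatE (a : 'I_n.-1) : onat a = o a.
Proof. by rewrite /onat valK. Qed.

Definition indicator_rep (X : pred nat) : rep k o :=
  @Rep k n o (fun i => X i) (fun a => const_mx 1).

(** There is at most one entry, so the sum of the entries is that entry; this reduces maps between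
    thin spaces to scalars. *)
Lemma bool_mxE (b c : bool) (M : 'M[k]_(b, c)) : M = const_mx (\sum_i \sum_j M i j).
Proof.
apply/matrixP; case: b M => M; last by move=> [].
case: c M => M i; last by move=> [].
by move=> j; rewrite mxE !big_ord1 !ord1.
Qed.

Lemma const_mx_mul b c d (u w : k) :
  (const_mx u : 'M_(b, c)) *m const_mx w = const_mx (c%:R * (u * w)) :> 'M_(b, d).
Proof.
apply/matrixP => i j; rewrite !mxE.
under eq_bigr do rewrite !mxE.
by rewrite sumr_const card_ord mulr_natl.
Qed.

Lemma ext1_indicator X Y : ext_free onat X Y ->
  ext1_zero (indicator_rep X) (indicator_rep Y).
Proof.
move=> XY h; pose eta a := \sum_i \sum_j h a i j.
(* Ringel's equation at an arrow becomes a scalar one, nontrivial only when the source lies in [X]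
   and the target in [Y]. The scalars [phi] are then found by recursion from the end that [ext_free]
   allows. *)
suff [phi Hphi] : exists phi : nat -> k, forall a : 'I_n.-1,
    X (asrc o a) -> Y (atgt o a) ->
    eta a = (X (atgt o a))%:R * phi (atgt o a) - (Y (asrc o a))%:R * phi (asrc o a).
  exists (fun i => const_mx (phi i) : 'M_(X i, Y i)) => a; rewrite /= !const_mx_mul mul1r mulr1.
  have e := Hphi a; rewrite [LHS]bool_mxE -/(eta a); apply/matrixP => i j.
  have XY_pos (b : bool) (l : 'I_b) : b by case: b l => // -[].
  by rewrite !mxE e //; [exact: XY_pos i | exact: XY_pos j].
pose eta' i := if (insub i : option 'I_n.-1) is Some a then eta a else 0.
have eta'E (a : 'I_n.-1) : eta' a = eta a by rewrite /eta' valK.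
case: XY => XY.
- have [phi Hphi] := rec_down_exists (fun i x => if onat i then
    (X i.+1)%:R * x - eta' i else eta' i + (Y i.+1)%:R * x) 0 n.
  exists phi => a; have XYa := XY a; move: XYa; rewrite /arrow_between onatE.
  have := Hphi a; rewrite onatE eta'E (leq_trans (ltn_ord a) (leq_pred n)) => /(_ isT).
  rewrite /asrc /atgt; case: (o a) => /= -> XYa Xa Ya; move: XYa; rewrite ?Xa ?Ya /=.
  + by move=> /(_ isT) ->; rewrite mul1r; ring.
  + by move=> /(_ isT); rewrite andbT => ->; rewrite mul1r; ring.
- have [phi Hphi] := rec_up_exists (fun i x => if onat i then
    eta' i + (Y i)%:R * x else (X i)%:R * x - eta' i) 0.
  exists phi => a; have XYa := XY a; move: XYa; rewrite /arrow_between onatE.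
  have := Hphi a; rewrite onatE eta'E.
  rewrite /asrc /atgt; case: (o a) => /= -> XYa Xa Ya; move: XYa; rewrite ?Xa ?Ya /=.
  + by move=> /(_ isT); rewrite andbT => ->; rewrite mul1r; ring.
  + by move=> /(_ isT) ->; rewrite mul1r; ring.
Qed.

Lemma indicator_rep_iso X Y : rep_iso (indicator_rep X) (indicator_rep Y) ->
  forall i : 'I_n, X i = Y i.
Proof.
move=> [f [g [_ _ fg gf]]] i; move: (f i) (g i) (fg i) (gf i) => /=.
by case: (X i) (Y i) => [] [] // A B /mulmx1_min // _ /mulmx1_min.
Qed.

(** Arrows inside the interval are injective, so the ranks of [U] and [U'] cannot drop along them,
    while their sum stays 1. Both are therefore constant on the interval, and one is zero. *)
Lemma indicator_interval_indecomposable a b : (a < b <= n)%N ->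
  indecomposable (indicator_rep (initv (a, b))).
Proof.
move=> /andP[ab bn]; have an : (a < n)%N by exact: leq_trans ab bn.
split; first by exists (Ordinal an); rewrite /= /initv /= leqnn ab.
move=> U U' sU sU' direct; set X := initv (a, b) in U U' sU sU' direct *.
have rk_sum i : (\rank (U i) + \rank (U' i) = X i)%N.
  have /andP[cap0 full] := direct i.
  rewrite -mxrank_sum_cap; move: cap0; rewrite submx0 => /eqP ->.
  rewrite mxrank0 addn0; apply/eqP; rewrite eqn_leq rank_leq_row /=.
  by have := mxrankS full; rewrite mxrank1.
have free (c d : bool) : c -> d -> row_free (const_mx 1 : 'M[k]_(c, d)).
  case: c d => [] [] // _ _; rewrite -row_leq_rank lt0n mxrank_eq0.
  by apply/eqP => /matrixP/(_ 0 0)/eqP; rewrite !mxE oner_eq0.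
have rk_arrow (W : forall i, 'M[k]_(dimv (indicator_rep X) i)) (i : 'I_n.-1) :
    subrep W -> X i -> X i.+1 -> (\rank (W (asrc o i)) <= \rank (W (atgt o i)))%N.
  move=> sW Xi XSi; have := mxrankS (sW i); rewrite mxrankMfree //.
  by apply: free; rewrite /asrc /atgt; case: (o i).
have arith_up (p q r s : nat) :
  (p + q = 1 -> r + s = 1 -> s <= q -> r <= p -> p = r)%N by lia.
have arith_down (p q r s : nat) :
  (p + q = 1 -> r + s = 1 -> q <= s -> p <= r -> p = r)%N by lia.
have rk_const (i : 'I_n) : X i -> \rank (U i) = \rank (U (Ordinal an)).
  case: i; elim=> [|i IH] ii Xi.
    have a0 : a = 0%N by move: Xi; rewrite /X /initv /=; lia.
    by congr (\rank (U _)); apply: val_inj.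
  have [ai|ai] := eqVneq a i.+1; first by congr (\rank (U _)); apply: val_inj.
  have Xi' : X i by move: Xi ai; rewrite /X /initv /=; lia.
  have iin : (i < n.-1)%N by lia.
  rewrite -(IH (ltnW ii) Xi').
  have lo : Ordinal (ltnW ii) = alo (Ordinal iin) by apply: val_inj.
  have hi : Ordinal ii = ahi (Ordinal iin) by apply: val_inj.
  have := rk_arrow _ (Ordinal iin) sU Xi' Xi; have := rk_arrow _ (Ordinal iin) sU' Xi' Xi.
  have := rk_sum (alo (Ordinal iin)); have := rk_sum (ahi (Ordinal iin)).
  rewrite lo hi /asrc /atgt [X (ahi _)]Xi [X (alo _)]Xi' /=.
  by case: (o _); [exact: arith_up | exact: arith_down].
have rk0 (W : forall i : 'I_n, 'M[k]_(X i)) : (forall i : 'I_n, X i -> \rank (W i) = 0%N) ->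
    forall i, W i = 0.
  move=> W0 i; apply/eqP; rewrite -mxrank_eq0; case/orP: (orbN (X i)) => [/W0 -> //|/negbTE Xi].
  by rewrite -leqn0 (leq_trans (rank_leq_row _)) // Xi.
have [U0|Upos] := posnP (\rank (U (Ordinal an))).
  by left; apply: rk0 => i Xi; rewrite rk_const.
right; apply: rk0 => i Xi; have : (\rank (U i) + \rank (U' i) = 1)%N by rewrite rk_sum Xi.
by rewrite rk_const //; move: Upos; case: (\rank (U _)) => // -[|r] //= _ [].
Qed.

End IntervalModules.

(** * Convex hulls *)

Section Convexity.
Variables (R : realFieldType) (n : nat).
Implicit Types (S : seq 'rV[R]_n) (x : 'rV[R]_n).

Lemma conv_weighted (Z : seq ('rV[R]_n * R)) :
  (forall z, z \in Z -> 0 <= z.2) -> weight Z = 1 ->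
  conv (map fst Z) (\sum_(z <- Z) z.2 *: z.1).
Proof.
move=> Z0 Z1; exists (fun i => (nth (0, 0) Z i).2); split.
- by move=> i; apply/Z0/mem_nth; rewrite -(size_map fst Z).
- by rewrite -Z1 /weight (big_nth (0, 0)) big_mkord size_map.
- rewrite (big_nth (0, 0)) big_mkord size_map; apply: eq_bigr => i _.
  by rewrite (nth_map (0, 0)).
Qed.

(** The missing weight is put on the origin. *)
Lemma conv_weighted0 (Z : seq ('rV[R]_n * R)) :
  (forall z, z \in Z -> 0 <= z.2) -> weight Z <= 1 ->
  conv (0 :: map fst Z) (\sum_(z <- Z) z.2 *: z.1).
Proof.
move=> Z0 Z1; have := @conv_weighted ((0, 1 - weight Z) :: Z).
rewrite /weight !big_cons /= -/(weight Z) scaler0 add0r subrK; apply=> //.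
by move=> z; rewrite inE => /orP[/eqP ->|/Z0 //]; rewrite subr_ge0.
Qed.

Lemma conv_mem S s : s \in S -> conv S s.
Proof.
move=> sS; have iS : (index s S < size S)%N by rewrite index_mem.
exists (fun i => (i == Ordinal iS)%:R); split.
- by move=> i; rewrite ler0n.
- by rewrite (bigD1 (Ordinal iS)) //= eqxx big1 ?addr0 // => i /negbTE ->.
- rewrite (bigD1 (Ordinal iS)) //= eqxx big1 ?addr0; last by move=> i /negbTE ->; rewrite scale0r.
  by rewrite scale1r nth_index.
Qed.

Lemma conv_sub S S' x : (forall s, s \in S -> conv S' s) -> conv S x -> conv S' x.
Proof.
move=> SS' [w [w0 w1 ->]].
have /fin_all_exists[u Hu] : forall i : 'I_(size S), exists u : 'I_(size S') -> R,
    [/\ forall j, 0 <= u j, \sum_j u j = 1 & S`_i = \sum_j u j *: S'`_j].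
  by move=> i; apply/SS'/mem_nth.
exists (fun j => \sum_i w i * u i j); split.
- by move=> j; apply: sumr_ge0 => i _; apply: mulr_ge0 => //; case: (Hu i).
- rewrite exchange_big -[RHS]w1; apply: eq_bigr => i _ /=.
  by rewrite -mulr_sumr; have [_ -> _] := Hu i; rewrite mulr1.
- under [RHS]eq_bigr do rewrite scaler_suml.
  rewrite exchange_big /=; apply: eq_bigr => i _.
  have [_ _ {1}->] := Hu i; rewrite scaler_sumr; apply: eq_bigr => j _.
  by rewrite scalerA.
Qed.

Lemma conv0_opp S s : s \in S -> - s \in S -> conv S 0.
Proof.
move=> sS nsS; apply: (@conv_sub [:: s; - s]) => [t|].
  by rewrite !inE => /orP[] /eqP ->; apply: conv_mem.
have := @conv_weighted [:: (s, 2^-1); (- s, 2^-1)].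
rewrite /weight !big_cons !big_nil /= scalerN !addr0 subrr; apply; last by field.
by move=> z; rewrite !inE => /orP[] /eqP -> /=; rewrite invr_ge0 ler0n.
Qed.

Lemma conv_sublinear_le (F : 'rV[R]_n -> R) (b : R) S x :
  (forall y z, F (y + z) <= F y + F z) ->
  (forall c y, 0 <= c -> F (c *: y) = c * F y) ->
  (forall s, s \in S -> F s <= b) -> conv S x -> F x <= b.
Proof.
move=> Fadd Fhom Fb [w [w0 w1 ->]].
have F0 : F 0 = 0 by rewrite -(scale0r 0) Fhom // mul0r.
apply: le_trans (_ : \sum_i w i * F S`_i <= _).
  apply: (big_ind2 (fun y r => F y <= r)) => [|y r z t yr zt|i _]; rewrite ?F0 ?Fhom //.
  by apply: le_trans (Fadd _ _) _; apply: lerD.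
rewrite -[b]mul1r -w1 mulr_suml; apply: ler_sum => i _.
by apply: ler_wpM2l => //; apply/Fb/mem_nth.
Qed.

End Convexity.

(** * Sums over the edges of the path extended by zeros *)

Section PathSum.
Variables (R : realFieldType) (n : nat).
Implicit Types (x y : 'rV[R]_n) (phi : R -> R -> R).

Definition extend x (i : nat) : R :=
  if (insub i : option 'I_n) is Some j then x 0 j else 0.

Lemma extendE x (i : 'I_n) : extend x i = x 0 i.
Proof. by rewrite /extend valK. Qed.

Lemma extend_out x i : (n <= i)%N -> extend x i = 0.
Proof. by move=> ni; rewrite /extend insubF // ltnNge ni. Qed.

Lemma extend_map (f : R -> R) x i : f 0 = 0 ->
  extend (\row_j f (x 0 j)) i = f (extend x i).
Proof. by move=> f0; rewrite /extend; case: insub => [j|] //; rewrite mxE. Qed.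

Definition path_sum phi x := \sum_(0 <= i < n.+1) phi (shift (extend x) i) (extend x i).

Lemma path_sumD phi x y :
  (forall a b c d, phi (a + c) (b + d) <= phi a b + phi c d) ->
  path_sum phi (x + y) <= path_sum phi x + path_sum phi y.
Proof.
move=> phiD; rewrite -big_split /=; apply: ler_sum => i _.
have extD j : extend (x + y) j = extend x j + extend y j.
  by rewrite /extend; case: insub => [l|]; rewrite ?addr0 // mxE.
rewrite extD (_ : shift _ i = shift (extend x) i + shift (extend y) i) //.
by case: i => [|i] /=; rewrite ?addr0.
Qed.

Lemma path_sumZ phi c x :
  (forall a b, phi (c * a) (c * b) = c * phi a b) ->
  path_sum phi (c *: x) = c * path_sum phi x.
Proof.
move=> phiM; rewrite mulr_sumr; apply: eq_bigr => i _; rewrite -phiM.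
have extM j : extend (c *: x) j = c * extend x j.
  by rewrite /extend; case: insub => [l|]; rewrite ?mulr0 // mxE.
rewrite extM (_ : shift _ i = c * shift (extend x) i) //.
by case: i => [|i] /=; rewrite ?mulr0.
Qed.

Definition root_row (a b : nat) : 'rV[R]_n := \row_l ((a <= l <= b)%N)%:R.

Lemma extend_root a b i : (b < n)%N -> extend (root_row a b) i = (a <= i <= b)%N%:R.
Proof.
move=> bn; rewrite /extend; case: insubP => [j _ <-|]; first by rewrite mxE.
by rewrite -leqNgt => ni; rewrite (_ : (_ && _) = false) //; lia.
Qed.

Lemma shift_root a b i : (b < n)%N ->
  shift (extend (root_row a b)) i = (a < i <= b.+1)%N%:R.
Proof. by move=> bn; case: i => [|i] //=; rewrite extend_root. Qed.

Lemma sum_pred1_le1 a m : \sum_(0 <= i < m) ((i == a)%:R : R) <= 1.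
Proof.
elim: m => [|m IH]; first by rewrite big_nil ler01.
rewrite big_nat_recr //=; case: eqP => [ma|_]; last by rewrite addr0.
by rewrite big_nat big1 ?add0r // => i /andP[_ im]; rewrite -ma ltn_eqF.
Qed.

(** A root jumps only on the edges entering [a] and [b.+1]; the hypothesis charges at most 1 to each
    of them and nothing elsewhere. *)
Lemma path_sum_root_le2 phi a b e : (b < n)%N ->
  (forall i, phi (e * (a < i <= b.+1)%N%:R) (e * (a <= i <= b)%N%:R)
             <= (i == a)%:R + (i == b.+1)%:R) ->
  path_sum phi (e *: root_row a b) <= 2.
Proof.
move=> bn phi_le.
apply: le_trans (_ : \sum_(0 <= i < n.+1) ((i == a)%:R + (i == b.+1)%:R : R) <= _).
  apply: ler_sum => i _; apply: le_trans (phi_le i).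
  have extM j : extend (e *: root_row a b) j = e * extend (root_row a b) j.
    by rewrite /extend; case: insub => [l|]; rewrite ?mulr0 // mxE.
  rewrite extM extend_root // -shift_root //.
  by case: i => [|i] /=; rewrite ?mulr0 ?extM ?lexx.
rewrite big_split /=; apply: le_trans (lerD (sum_pred1_le1 _ _) (sum_pred1_le1 _ _)) _.
by rewrite lexx.
Qed.

Lemma mem_pos_roots s : reflect (exists i j : 'I_n, (i <= j)%N /\ s = root_row i j)
  (s \in pos_roots R n).
Proof.
apply: (iffP mapP) => [[[i j]]|[i [j [ij ->]]]].
  by rewrite mem_filter /= => /andP[ij _] ->; exists i, j.
exists (i, j) => //; rewrite mem_filter ij /=; apply/allpairsP.
by exists (i, j); rewrite !mem_enum.
Qed.

Lemma evec_root (j : 'I_n) : evec R j = root_row j j.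
Proof.
apply/rowP => l; rewrite !mxE eqxx /= -eqn_leq.
by rewrite -(inj_eq val_inj) /= eq_sym.
Qed.

End PathSum.

(** * The two convex functions that measure the total weight *)

Section PathNorms.
Variables (R : realFieldType) (n : nat).
Implicit Types (u v : R) (x : 'rV[R]_n).

Definition full_step u v : R := `|v - u|.
Definition clus_step u v : R := Num.max `|v - u| (- (u + v)).

Lemma full_stepD a b c d : full_step (a + c) (b + d) <= full_step a b + full_step c d.
Proof.
rewrite /full_step (_ : _ - _ = (b - a) + (d - c)); last by ring.
exact: ler_normD.
Qed.

Lemma full_stepM c a b : 0 <= c -> full_step (c * a) (c * b) = c * full_step a b.
Proof. by move=> c0; rewrite /full_step -mulrBr normrM ger0_norm. Qed.

Lemma clus_stepD a b c d : clus_step (a + c) (b + d) <= clus_step a b + clus_step c d.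
Proof.
rewrite {1}/clus_step ge_max; apply/andP; split.
  by apply: le_trans (full_stepD _ _ _ _) _; apply: lerD; rewrite le_max lexx.
rewrite (_ : - _ = - (a + b) + - (c + d)); last by ring.
by apply: lerD; rewrite le_max lexx orbT.
Qed.

Lemma clus_stepM c a b : 0 <= c -> clus_step (c * a) (c * b) = c * clus_step a b.
Proof.
move=> c0; rewrite /clus_step maxr_pMr // -mulrBr normrM (ger0_norm c0).
by congr (Num.max _ _); ring.
Qed.

Definition pos_part u : R := if 0 <= u then u else 0.
Definition neg_part u : R := if 0 <= u then 0 else - u.

Lemma pos_part_ge0 u : 0 <= pos_part u.
Proof. by rewrite /pos_part; case: ifP. Qed.

Lemma neg_part_ge0 u : 0 <= neg_part u.
Proof. by rewrite /neg_part; case: (lerP 0 u) => // u0; rewrite oppr_ge0 ltW. Qed.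

Lemma pos_part0 : pos_part 0 = 0. Proof. by rewrite /pos_part lexx. Qed.
Lemma neg_part0 : neg_part 0 = 0. Proof. by rewrite /neg_part lexx. Qed.

Lemma pos_neg_part u : pos_part u - neg_part u = u.
Proof. by rewrite /pos_part /neg_part; case: ifP => _; ring. Qed.

(** A jump between opposite signs passes through [0] and splits there. *)
Lemma full_step_parts u v :
  full_step (pos_part u) (pos_part v) + full_step (neg_part u) (neg_part v) = full_step u v.
Proof.
rewrite /full_step /pos_part /neg_part.
by case: (lerP 0 u) => u0; case: (lerP 0 v) => v0; do ?[case: ger0P => ?]; lra.
Qed.

(** Explains the maximum in [clus_step]: the positive part pays its jump, while the negative part,
    covered by opposite simple roots, pays its values at both ends of the edge. *)
Lemma clus_step_parts u v :
  full_step (pos_part u) (pos_part v) + (neg_part u + neg_part v) = clus_step u v.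
Proof.
rewrite /clus_step /full_step /pos_part /neg_part.
by case: (lerP 0 u) => u0; case: (lerP 0 v) => v0; do ?[case: ger0P => ?];
  case: lerP => ?; lra.
Qed.

Definition pos_row x : 'rV[R]_n := \row_j pos_part (x 0 j).
Definition neg_row x : 'rV[R]_n := \row_j neg_part (x 0 j).

Lemma pos_neg_row x : pos_row x - neg_row x = x.
Proof. by apply/rowP => j; rewrite !mxE pos_neg_part. Qed.

Lemma extend_pos_row x i : extend (pos_row x) i = pos_part (extend x i).
Proof. exact: extend_map pos_part0. Qed.
Lemma extend_neg_row x i : extend (neg_row x) i = neg_part (extend x i).
Proof. exact: extend_map neg_part0. Qed.
Lemma shift_pos_row x i : shift (extend (pos_row x)) i = pos_part (shift (extend x) i).
Proof. by case: i => [|i] /=; rewrite ?pos_part0 ?extend_pos_row. Qed.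
Lemma shift_neg_row x i : shift (extend (neg_row x)) i = neg_part (shift (extend x) i).
Proof. by case: i => [|i] /=; rewrite ?neg_part0 ?extend_neg_row. Qed.

Lemma path_sum_full_parts x :
  path_sum full_step (pos_row x) + path_sum full_step (neg_row x) = path_sum full_step x.
Proof.
rewrite -big_split; apply: eq_bigr => i _ /=.
by rewrite extend_pos_row extend_neg_row shift_pos_row shift_neg_row full_step_parts.
Qed.

Lemma sum_shift_extend x :
  \sum_(0 <= i < n.+1) (shift (extend x) i + extend x i) = 2 * \sum_j x 0 j.
Proof.
have e : \sum_(0 <= i < n) extend x i = \sum_j x 0 j.
  by rewrite big_mkord; apply: eq_bigr => j _; rewrite extendE.
rewrite big_split /= big_nat_recl // [X in _ + X]big_nat_recr //= extend_out // e.
by ring.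
Qed.

Lemma path_sum_clus_parts x :
  path_sum full_step (pos_row x) + 2 * (\sum_j neg_row x 0 j) = path_sum clus_step x.
Proof.
rewrite -sum_shift_extend -big_split; apply: eq_bigr => i _ /=.
by rewrite extend_pos_row extend_neg_row shift_pos_row shift_neg_row clus_step_parts.
Qed.

Lemma root_step_le (a b i : nat) (e : R) : (a <= b)%N -> `|e| = 1 ->
  full_step (e * (a < i <= b.+1)%N%:R) (e * (a <= i <= b)%N%:R)
    <= (i == a)%:R + (i == b.+1)%:R.
Proof.
move=> ab e1; rewrite /full_step -mulrBr normrM e1 mul1r.
have [->|ia] := eqVneq i a.
  rewrite ltnn leqnn ab (_ : (a == b.+1) = false) /=; last by lia.
  by rewrite subr0 addr0 normr1.
have [->|ib] := eqVneq i b.+1.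
  rewrite ltnS ab leqnn ltnn andbF /= sub0r normrN normr1 add0r //.
rewrite (_ : (a < i <= b.+1)%N = (a <= i <= b)%N); last by lia.
by rewrite subrr normr0 addr0.
Qed.

Lemma path_sum_full_root (a b : nat) e : (a <= b < n)%N -> `|e| = 1 ->
  path_sum full_step (e *: root_row R n a b) <= 2.
Proof. by move=> /andP[ab bn] e1; apply: path_sum_root_le2 => // i; apply: root_step_le. Qed.

Lemma path_sum_clus_root (a b : nat) : (a <= b < n)%N ->
  path_sum clus_step (root_row R n a b) <= 2.
Proof.
move=> /andP[ab bn]; rewrite -[root_row _ _ _ _]scale1r; apply: path_sum_root_le2 => // i.
rewrite ge_max root_step_le ?normr1 //= !mul1r.
by apply: le_trans (addr_ge0 _ _); rewrite ?oppr_le0 ?addr_ge0 ?ler0n.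
Qed.

Lemma path_sum_clus_opp_simple (j : 'I_n) : path_sum clus_step (- evec R j) <= 2.
Proof.
rewrite evec_root -scaleN1r; apply: path_sum_root_le2 => // i.
rewrite ge_max root_step_le ?normrN1 //= !mulN1r -opprD opprK.
rewrite addrC; apply: lerD; rewrite ler_nat.
  by rewrite -eqn_leq eq_sym.
by rewrite (_ : (j < i <= j.+1)%N = (i == j.+1)) //; lia.
Qed.

End PathNorms.

(** * Comparison of the polytopes *)

Section Cones.
Variables (k : fieldType) (R : realFieldType) (n : nat) (o : 'I_n.-1 -> bool).

Definition interval_rep (p : nat * nat) : rep k o := indicator_rep k o (initv p).

Definition interval_modules (Z : seq ((nat * nat) * R)) : seq (rep k o) :=
  map interval_rep (unzip1 Z).

Lemma cone_cover (I : {set 'I_n}) (x : 'rV[R]_n) :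
  (forall i, 0 <= x 0 i) -> (forall i, i \notin I -> x 0 i = 0) ->
  exists Z : seq ((nat * nat) * R),
    [/\ tilting_over I (interval_modules Z), supp (interval_modules Z) = I,
        forall z, z \in Z -> 0 <= z.2,
        \sum_(z <- Z) z.2 *: dimvec R (interval_rep z.1) = x
      & 2 * weight Z = path_sum (@full_step R) x].
Proof.
move=> x0 xI; pose J i := if (insub i : option 'I_n) is Some j then j \in I else false.
have JE (i : 'I_n) : J i = (i \in I) by rewrite /J valK.
have y0 i : 0 <= extend x i by rewrite /extend; case: insub.
have yJ i : ~~ J i -> extend x i = 0.
  by rewrite /J /extend; case: insub => // j; apply: xI.
have [Z [[Z0 uZ Zn] [ZJ JZ sZ] Zext Zsum ZW]] := rigid_family (onat o) y0 yJ n.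
have zn i : (i < size Z)%N -> nth (0, 0)%N (unzip1 Z) i \in unzip1 Z.
  by move=> iZ; rewrite mem_nth // size_map.
have nthT i : (i < size Z)%N ->
    nth (rep0 k o) (interval_modules Z) i = interval_rep (nth (0, 0)%N (unzip1 Z) i).
  by move=> iZ; rewrite (nth_map (0, 0)%N) ?size_map.
have szT : size (interval_modules Z) = size Z by rewrite !size_map.
exists Z; split=> //.
- split; rewrite szT.
  + rewrite sZ -val_enum_ord count_map cardE /enum_mem size_filter -enumT.
    by rewrite count_filter; apply: eq_count => i; rewrite /= JE andbT.
  + move=> i iZ; rewrite nthT //; split.
      by apply: indicator_interval_indecomposable; case/andP: (Zn _ (zn _ iZ)) => -> ->.
    apply/subsetP => l; rewrite inE /= lt0b => li.
    by rewrite -JE; apply: ZJ (zn _ iZ) li.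
  + move=> i j iZ jZ ij; rewrite !nthT // => /indicator_rep_iso e.
    apply: ij; apply/eqP; rewrite -(nth_uniq (0, 0)%N _ _ uZ) ?size_map //; apply/eqP.
    move: e (Zn _ (zn _ iZ)) (Zn _ (zn _ jZ)).
    case: (nth _ _ i) (nth _ _ j) => [a b] [c d] /= e /andP[ab bn] /andP[cd dn].
    have e' l : (l < n)%N -> initv (a, b) l = initv (c, d) l.
      by move=> ln; apply: (e (Ordinal ln)).
    have := e' a; have := e' b.-1; have := e' c; have := e' d.-1.
    rewrite /initv /= => e1 e2 e3 e4.
    by congr pair; lia.
  + by move=> i j iZ jZ; rewrite !nthT //; apply/ext1_indicator/Zext; apply: zn.
- apply/setP => i; rewrite inE has_map; apply/hasP/idP => [[p pZ]|iI].
    by rewrite /= lt0b => pi; rewrite -JE; apply: ZJ pZ pi.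
  by have [||p pZ pi] := JZ i; rewrite ?ltn_ord ?JE //; exists p; rewrite //= lt0b.
- apply/rowP => i; rewrite -[RHS]extendE -Zsum // summxE.
  by apply: eq_bigr => z _; rewrite !mxE.
(* The boundary term is the last edge, leading to the final [0]. *)
- rewrite ZW /path_sum big_nat_recr //=; congr (_ + _).
  have sh_ge0 m : 0 <= shift (extend x) m by case: m => [|m] /=.
  by rewrite /full_step extend_out // sub0r normrN ger0_norm.
Qed.

Lemma dimvec_root (V : rep k o) : indecomposable V -> dimvec R V \in pos_roots R n.
Proof.
move=> /indecomposable_interval[i [j [ij dimV]]].
apply/mem_pos_roots; exists i, j; split=> //.
by apply/rowP => l; rewrite !mxE dimV.
Qed.

Lemma tilting_roots (I : {set 'I_n}) (T : seq (rep k o)) s :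
  tilting_over I T -> s \in map (@dimvec R n k o) T -> s \in pos_roots R n.
Proof.
move=> [_ indT _ _] /(nthP 0)[i]; rewrite size_map => iT <-.
by rewrite (nth_map (rep0 k o)) //; apply: dimvec_root; case: (indT _ iT).
Qed.

Lemma Pplus_Cplus (x : 'rV[R]_n) : Pplus k o x -> Cplus x.
Proof.
move=> [T [tT]]; apply: conv_sub => s; rewrite inE => /orP[/eqP->|/(tilting_roots tT) sT].
  by apply: conv_mem; rewrite inE eqxx.
by apply: conv_mem; rewrite inE sT orbT.
Qed.

Lemma pos_rootE (i j : 'I_n) : (i <= j)%N -> root_row R n i j \in pos_roots R n.
Proof. by move=> ij; apply/mem_pos_roots; exists i, j. Qed.

Lemma evec_pos_root (j : 'I_n) : evec R j \in pos_roots R n.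
Proof. by rewrite evec_root pos_rootE. Qed.

Lemma Pclus_Cclus (x : 'rV[R]_n) : (0 < n)%N -> Pclus k o x -> Cclus x.
Proof.
move=> n0 [T [tT]]; apply: conv_sub => s; rewrite inE mem_cat => /or3P[/eqP->|sT|].
(* The origin is the midpoint of a simple root and its opposite; [0 < n] provides one. *)
- apply: (@conv0_opp _ _ _ (evec R (Ordinal n0))); rewrite mem_cat ?evec_pos_root //.
  by rewrite (map_f (fun j => - evec R j)) ?mem_enum ?orbT.
- by apply: conv_mem; rewrite mem_cat (tilting_roots tT).
- move=> /mapP[j _ ->]; apply: conv_mem.
  by rewrite mem_cat (map_f (fun j => - evec R j)) ?mem_enum ?orbT.
Qed.

Lemma Pfull_Cfull (x : 'rV[R]_n) : (0 < n)%N -> Pfull k o x -> Cfull x.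
Proof.
move=> n0 [I [Tp [Tm [tTp tTm]]]]; apply: conv_sub => s.
rewrite inE mem_cat => /or3P[/eqP->|sT|].
- apply: (@conv0_opp _ _ _ (evec R (Ordinal n0))); rewrite mem_cat ?evec_pos_root //.
  by rewrite (map_f -%R) ?evec_pos_root ?orbT.
- by apply: conv_mem; rewrite mem_cat (tilting_roots tTp).
- rewrite (map_comp -%R) => /mapP[r rT ->]; apply: conv_mem.
  by rewrite mem_cat (map_f -%R) ?orbT // (tilting_roots tTm).
Qed.

Lemma path_sum_full_conv S (x : 'rV[R]_n) :
  (forall s, s \in S -> path_sum (@full_step R) s <= 2) -> conv S x ->
  path_sum (@full_step R) x <= 2.
Proof.
apply: conv_sublinear_le => [y z|c y c0].
  exact/path_sumD/full_stepD.
by apply: path_sumZ => a b; apply: full_stepM.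
Qed.

Lemma path_sum_clus_conv S (x : 'rV[R]_n) :
  (forall s, s \in S -> path_sum (@clus_step R) s <= 2) -> conv S x ->
  path_sum (@clus_step R) x <= 2.
Proof.
apply: conv_sublinear_le => [y z|c y c0].
  exact/path_sumD/clus_stepD.
by apply: path_sumZ => a b; apply: clus_stepM.
Qed.

Lemma path_sum_full_pos_root e s : `|e| = 1 -> s \in pos_roots R n ->
  path_sum (@full_step R) (e *: s) <= 2.
Proof.
by move=> e1 /mem_pos_roots[i [j [ij ->]]]; apply: path_sum_full_root; rewrite ?ij ?ltn_ord.
Qed.

Lemma sum_scalerN (T : Type) (r : seq T) (c : T -> R) (f : T -> 'rV[R]_n) :
  \sum_(i <- r) c i *: - f i = - \sum_(i <- r) c i *: f i.
Proof. by rewrite -sumrN; apply: eq_bigr => i _; rewrite scalerN. Qed.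

Lemma Cfull_Pfull (x : 'rV[R]_n) : Cfull x -> Pfull k o x.
Proof.
move=> /path_sum_full_conv Cx.
have {Cx} : path_sum (@full_step R) x <= 2.
  apply: Cx => s; rewrite mem_cat => /orP[sr|/mapP[r rr ->]].
    by rewrite -[s]scale1r path_sum_full_pos_root ?normr1.
  by rewrite -scaleN1r path_sum_full_pos_root ?normrN1.
rewrite -path_sum_full_parts; pose I := [set i | 0 <= x 0 i].
have [|i iI|Zp [tZp _ Zp0 Zpx <-]] := @cone_cover I (pos_row x).
- by move=> i; rewrite mxE pos_part_ge0.
- by move: iI; rewrite inE mxE /pos_part => /negbTE ->.
have [|i iI|Zm [tZm _ Zm0 Zmx <-]] := @cone_cover (~: I) (neg_row x).
- by move=> i; rewrite mxE neg_part_ge0.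
- by move: iI; rewrite !inE negbK mxE /neg_part => ->.
move=> W; exists I, (interval_modules Zp), (interval_modules Zm); split=> //.
(* The two covers together have weight half of [path_sum] of [full_step] at [x], hence at most 1. *)
pose Z := [seq (dimvec R (interval_rep z.1), z.2) | z <- Zp] ++
          [seq (- dimvec R (interval_rep z.1), z.2) | z <- Zm].
have := @conv_weighted0 _ _ Z; rewrite /weight /Z !big_cat !big_map /=.
rewrite sum_scalerN Zpx Zmx pos_neg_row /sigma2 map_cat -!map_comp; apply; last first.
  by rewrite -/(weight Zp) -/(weight Zm); lra.
by move=> z; rewrite mem_cat => /orP[] /mapP[y yZ ->]; [apply: Zp0 | apply: Zm0].
Qed.

Lemma Cclus_Pclus (x : 'rV[R]_n) : Cclus x -> Pclus k o x.
Proof.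
move=> /path_sum_clus_conv Cx.
have {Cx} : path_sum (@clus_step R) x <= 2.
  apply: Cx => s; rewrite mem_cat => /orP[/mem_pos_roots[i [j [ij ->]]]|/mapP[j _ ->]].
    by apply: path_sum_clus_root; rewrite ij ltn_ord.
  exact: path_sum_clus_opp_simple.
rewrite -path_sum_clus_parts; pose I := [set i | 0 <= x 0 i].
have [|i iI|Z [tZ sZ Z0 Zx <-]] := @cone_cover I (pos_row x).
- by move=> i; rewrite mxE pos_part_ge0.
- by move: iI; rewrite inE mxE /pos_part => /negbTE ->.
have negI i : i \in I -> neg_row x 0 i = 0 by rewrite inE mxE /neg_part => ->.
have sumI (V : zmodType) (f : 'I_n -> V) : (forall i, i \in I -> f i = 0) ->
    \sum_(i <- enum (~: I)) f i = \sum_i f i.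
  move=> f0; rewrite big_enum /= [RHS](bigID (mem (~: I))) /= [X in _ = _ + X]big1 ?addr0 //.
  by move=> i; rewrite inE negbK; apply: f0.
move=> W; exists (interval_modules Z); rewrite sZ; split=> //.
(* A vertex [j] outside [I] puts the weight [neg_row x 0 j] on [- evec R j]; with the cover of
   [pos_row x] this gives half of the path sum of [clus_step]. *)
pose Z' := [seq (dimvec R (interval_rep z.1), z.2) | z <- Z] ++
           [seq (- evec R j, neg_row x 0 j) | j <- enum (~: I)].
have := @conv_weighted0 _ _ Z'; rewrite /weight /Z' !big_cat !big_map /=.
rewrite (sumI _ (fun i => neg_row x 0 i)) //.
rewrite (sumI _ (fun i => neg_row x 0 i *: - evec R i)); last first.
  by move=> i /negI ->; rewrite scale0r.
rewrite sum_scalerN Zx -row_sum_delta pos_neg_row /sigma_clus sZ map_cat -!map_comp.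
apply; last first.
  by rewrite -/(weight Z); lra.
move=> z; rewrite mem_cat => /orP[] /mapP[y yZ ->]; first exact: Z0.
by rewrite /= mxE neg_part_ge0.
Qed.

Lemma Cplus_Pplus (x : 'rV[R]_n) : Cplus x -> Pplus k o x.
Proof.
move=> Cx.
have W : path_sum (@full_step R) x <= 2.
  apply: path_sum_full_conv Cx => s; rewrite inE => /orP[/eqP ->|sr].
    rewrite /path_sum big1 // => i _; rewrite /full_step.
    have e0 j : extend (0 : 'rV[R]_n) j = 0.
      by rewrite /extend; case: insub => // l; rewrite mxE.
    by case: i => [|i] /=; rewrite !e0 subrr normr0.
  by rewrite -[s]scale1r path_sum_full_pos_root ?normr1.
(* Coordinates are nonnegative on the generators, hence on the hull, so [x] itself can be covered
   over all vertices. *)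
have x0 i : 0 <= x 0 i.
  rewrite -oppr_le0.
  apply: (@conv_sublinear_le _ _ (fun y => - y 0 i) _ _ _ _ _ _ Cx) => [y z|c y c0|s].
  - by rewrite mxE opprD.
  - by rewrite mxE mulrN.
  by rewrite inE oppr_le0 => /orP[/eqP ->|/mem_pos_roots[a [b [_ ->]]]]; rewrite mxE ?ler0n.
have [i|Z [tZ _ Z0 Zx e]] := @cone_cover setT x x0; first by rewrite inE.
move: W; rewrite -e => W2; exists (interval_modules Z); split=> //.
pose Z' := [seq (dimvec R (interval_rep z.1), z.2) | z <- Z].
have := @conv_weighted0 _ _ Z'; rewrite /weight /Z' !big_map /=.
rewrite Zx /sigma_plus -!map_comp; apply; last by move: W2; rewrite -/(weight Z); lra.
by move=> z /mapP[y yZ ->]; apply: Z0.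
Qed.

End Cones.

Theorem theorem1p2 (k : fieldType) (R : realFieldType) (n : nat)
  (n_gt0 : (0 < n)%N) (o : 'I_n.-1 -> bool) :
  [/\ forall x : 'rV[R]_n, Cfull x <-> Pfull k o x,
      forall x : 'rV[R]_n, Cclus x <-> Pclus k o x
    & forall x : 'rV[R]_n, Cplus x <-> Pplus k o x].
Proof.
split=> x; split.
- exact: Cfull_Pfull.
- exact: Pfull_Cfull.
- exact: Cclus_Pclus.
- exact: Pclus_Cclus.
- exact: Cplus_Pplus.
- exact: Pplus_Cplus.
Qed.
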